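(* Consider a separately specified credal network over variables $X_1,\dots,X_n$ with an arbitrary acyclic directed graph, such that for every non-root node $i$ and every value $x_{\mathrm{pa}(i)}$ the local credal set $Q(X_i|x_{\mathrm{pa}(i)})$ consists of a single probability mass function, and for every root node $i$ the local credal set $Q(X_i)$ is the vacuous credal set (the set of all probability mass functions on $\mathcal X_i$). Let $q$ be a non-root node and $f:\mathcal X_q\to\mathbb R$ an arbitrary function. Then the result of the generalized Bayes rule for $f$ with no evidence, i.e. the value $\mu$ solving $\min_{p\in C(X)}\sum_{x\in\mathcal X}[f(x_q)-\mu]\,p(x)=0$ (equivalently $\mu=\min_{p\in C(X)}\mathbb E_p[f(X_q)]$), is the same whether $C(X)$ is the epistemic extension (epistemic irrelevance) or the strong extension (strong independence) of the network.
   Context: Let $X_1,\dots,X_n$ be variables with values in finite sets $\mathcal X_1,\dots,\mathcal X_n$, put $N=\{1,\dots,n\}$, $X=(X_1,\dots,X_n)$ and $\mathcal X=\mathcal X_1\times\dots\times\mathcal X_n$. For $I\subseteq N$, $X_I$ and $x_I$ denote the restrictions to the coordinates in $I$. A probability mass function (pmf) on a finite set $\mathcal Z$ is a non-negative real function on $\mathcal Z$ summing to 1, and $\mathbb E_p[f]=\sum_z f(z)p(z)$. A credal set is a closed convex set of pmfs on a finite set; $\mathrm{ext}$ denotes its set of extreme points. For an acyclic directed graph on $N$, $\mathrm{pa}(i)$ is the set of parents of $i$, a root node is a node with no parents, and $\mathrm{nd}(i)$ (the non-descendants of $i$) is the set of nodes other than $i$ not reachable from $i$ by a directed path. A separately specified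 credal network consists of an acyclic directed graph on $N$, a variable $X_i$ for each node $i$, and for each $i$ and each value $x_{\mathrm{pa}(i)}$ a local credal set $Q(X_i|x_{\mathrm{pa}(i)})$ of pmfs on $\mathcal X_i$ with finitely many extreme points. The strong extension is the convex hull of all pmfs $p$ on $\mathcal X$ of the form $p(x)=\prod_{i\in N}q(x_i|x_{\mathrm{pa}(i)})$ where $q(X_i|x_{\mathrm{pa}(i)})\in\mathrm{ext}\,Q(X_i|x_{\mathrm{pa}(i)})$ is chosen separately for each $i$ and each $x_{\mathrm{pa}(i)}$. The epistemic extension is the set of all pmfs $p$ on $\mathcal X$ such that for every $i\in N$ and every $x_{\mathrm{nd}(i)}$ with $p(x_{\mathrm{nd}(i)})>0$ one has $p(X_i|x_{\mathrm{nd}(i)})\in Q(X_i|x_{\mathrm{pa}(i)})$. *)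

(* Defs.v *)
From HB Require Import structures.
From mathcomp Require Import all_boot all_order all_algebra.
From mathcomp Require Import all_classical all_reals all_analysis.

Set Implicit Arguments.
Unset Strict Implicit.
Unset Printing Implicit Defensive.

Import Order.TTheory GRing.Theory Num.Theory.
Import numFieldNormedType.Exports.

Local Open Scope classical_set_scope.
Local Open Scope ring_scope.

Definition ext (R : realType) (E : lmodType R) (A : set E) : set E :=
  [set p | A p /\ forall (u v : E) (t : R),
     A u -> A v -> 0 < t < 1 -> p = t *: u + (1 - t) *: v -> u = v].

Definition conv_hull (R : realType) (E : lmodType R) (A : set E) : set E :=
  [set p | exists (m : nat) (w : 'I_m -> R) (s : 'I_m -> E),
     [/\ forall k, 0 <= w k, \sum_k w k = 1, forall k, A (s k)
       & p = \sum_k w k *: s k]].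

Definition is_min (R : realType) (A : set R) (m : R) : Prop :=
  A m /\ lbound A m.

Definition is_pmf (R : realType) (Z : finType) (p : Z -> R) : Prop :=
  (forall z, 0 <= p z) /\ \sum_z p z = 1.

Definition expect (R : realType) (Z : finType) (p f : Z -> R) : R :=
  \sum_z f z * p z.

(* [{ptws Z -> R}] is [Z -> R] with the product topology, i.e. the Euclidean
   topology since [Z] is finite. *)
Definition is_credal_set (R : realType) (Z : finType) (K : set (Z -> R)) : Prop :=
  [/\ K `<=` @is_pmf R Z, convex_set K & @closed {ptws Z -> R} K].

(* Values of X_I; the whole vector X takes its values in [joint X]. *)
Definition joint (n : nat) (X : 'I_n -> finType) : finType :=
  {dffun forall i : 'I_n, X i}.

Definition subjoint (n : nat) (X : 'I_n -> finType) (I : {set 'I_n}) : finType :=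
  {dffun forall j : {j : 'I_n | j \in I}, X (val j)}.

Definition restr (n : nat) (X : 'I_n -> finType) (I : {set 'I_n})
    (x : joint X) : subjoint X I :=
  [ffun j : {j : 'I_n | j \in I} => x (val j)].

Definition marg (R : realType) (n : nat) (X : 'I_n -> finType)
    (p : joint X -> R) (I : {set 'I_n}) (y : subjoint X I) : R :=
  \sum_(x : joint X | restr I x == y) p x.

(* p(X_i = a | X_I = y); meaningful when [marg p y] is positive. *)
Definition condp (R : realType) (n : nat) (X : 'I_n -> finType)
    (p : joint X -> R) (i : 'I_n) (I : {set 'I_n}) (y : subjoint X I)
    (a : X i) : R :=
  (\sum_(x : joint X | (restr I x == y) && (x i == a)) p x) / marg p y.

(* [e j i] is the arc from j to i. *)
Definition acyclic (n : nat) (e : rel 'I_n) : Prop :=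
  forall c : seq 'I_n, cycle e c -> c = [::].

Definition parents (n : nat) (e : rel 'I_n) (i : 'I_n) : {set 'I_n} :=
  [set j | e j i]%SET.

Definition nondesc (n : nat) (e : rel 'I_n) (i : 'I_n) : {set 'I_n} :=
  [set j | (j != i) && ~~ connect e i j]%SET.

Record credal_net (R : realType) (n : nat) (X : 'I_n -> finType) := CredalNet {
  arc : rel 'I_n;
  arc_acyclic : acyclic arc;
  lcs : forall i : 'I_n, subjoint X (parents arc i) -> set (X i -> R);
  lcs_credal : forall i y, is_credal_set (@lcs i y);
  lcs_finite_ext : forall i y, finite_set (ext (@lcs i y)) }.

Definition pa (R : realType) (n : nat) (X : 'I_n -> finType)
  (N : credal_net R X) (i : 'I_n) : {set 'I_n} := parents (arc N) i.

Definition nd (R : realType) (n : nat) (X : 'I_n -> finType)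
  (N : credal_net R X) (i : 'I_n) : {set 'I_n} := nondesc (arc N) i.

Definition is_root (R : realType) (n : nat) (X : 'I_n -> finType)
  (N : credal_net R X) (i : 'I_n) : bool := pa N i == finset.set0.

Definition strong_ext (R : realType) (n : nat) (X : 'I_n -> finType)
    (N : credal_net R X) : set (joint X -> R) :=
  conv_hull [set p | is_pmf p /\
    exists q : forall i : 'I_n, subjoint X (pa N i) -> X i -> R,
      (forall i y, ext (lcs y) (q i y)) /\
      (forall x, p x = \prod_i q i (restr (pa N i) x) (x i))].

(* The value x_nd(i) is given as the restriction of a full configuration x,
   which also determines the value of the parents (a subset of nd(i)). *)
Definition epistemic_ext (R : realType) (n : nat) (X : 'I_n -> finType)
    (N : credal_net R X) : set (joint X -> R) :=
  [set p | is_pmf p /\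
    forall (i : 'I_n) (x : joint X),
      0 < marg p (restr (nd N i) x) ->
      lcs (restr (pa N i) x) (condp p (i := i) (restr (nd N i) x))].

Definition gbr_sol (R : realType) (n : nat) (X : 'I_n -> finType)
    (C : set (joint X -> R)) (q : 'I_n) (f : X q -> R) (mu : R) : Prop :=
  is_min [set \sum_(x : joint X) (f (x q) - mu) * p x | p in C] 0.

Definition lower_expect (R : realType) (n : nat) (X : 'I_n -> finType)
    (C : set (joint X -> R)) (q : 'I_n) (f : X q -> R) (mu : R) : Prop :=
  is_min [set expect p (fun x : joint X => f (x q)) | p in C] mu.

(* Main.v *)
Require Import Defs.
From mathcomp Require Import all_boot all_order all_algebra.
From mathcomp Require Import all_classical all_reals all_analysis.

Set Implicit Arguments.
Unset Strict Implicit.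
Unset Printing Implicit Defensive.

Import Order.TTheory GRing.Theory Num.Theory.

Local Open Scope classical_set_scope.
Local Open Scope ring_scope.

(* Fixing the values r of the roots leaves one distribution P_r, the product of
   the point masses at r_i (i a root) and of the precise conditionals. Each P_r
   is a vertex of the strong extension and lies in the epistemic extension.
   Conversely, processing the nodes in a topological order that starts with all
   the roots, which are non-descendants of every other node, the chain rule
   gives p(x) = p(x_roots) * \prod_(i nonroot) q_i(x_i | x_pa(i)) for each p in
   the epistemic extension, so p is the mixture \sum_r p(r) P_r. Products of
   kernels taken in the local credal sets satisfy epistemic irrelevance, so this
   applies to the vertices of the strong extension as well. Both lower
   expectations are therefore equal to \min_r E_(P_r)[f]. *)

(** * Ancestral sets and topological induction in acyclic digraphs *)

Definition ancestral (n : nat) (e : rel 'I_n) (A : {set 'I_n}) : Prop :=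
  forall i, i \in A -> parents e i \subset A.

(* all_classical shadows the lemma names of fintype and finset. *)
Section Ancestral.
Import boot.fintype boot.finset.
Variables (n : nat) (e : rel 'I_n).
Implicit Types (A : {set 'I_n}) (i j : 'I_n).

Lemma ancestral_connect A i j :
  ancestral e A -> connect e i j -> j \in A -> i \in A.
Proof.
move=> ancA /connectP[s + ->]; elim: s i => [|k s IH] i //= /andP[eik pks] kA.
by apply: (subsetP (ancA _ (IH _ pks kA))); rewrite inE.
Qed.

Lemma ancestralU1 A i :
  ancestral e A -> parents e i \subset A -> ancestral e (i |: A)%SET.
Proof.
move=> ancA piA j; rewrite in_setU1 => /predU1P[->|/ancA pjA];
  by apply: (subset_trans _ (subsetUr _ _)).
Qed.

Lemma ancestral_nondesc i : ancestral e (nondesc e i).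
Proof.
move=> j; rewrite inE => /andP[_ nij]; apply/subsetP => k; rewrite !inE => ekj.
apply/andP; split; apply: contra nij.
  by move=> /eqP <-; exact: connect1.
by move=> ik; exact: connect_trans ik (connect1 ekj).
Qed.

(** A descendant of [i] in [A] would force [i] itself into [A]. This lets the chain rule condition
    on an arbitrary ancestral set of earlier nodes. *)
Lemma sub_nondesc A i : ancestral e A -> i \notin A -> A \subset nondesc e i.
Proof.
move=> ancA iA; apply/subsetP => j jA; rewrite inE.
by rewrite (memPn iA) //=; apply: contra iA => /ancestral_connect; apply.
Qed.

Hypothesis e_acyclic : acyclic e.

Lemma arc_notC i j : e i j -> ~~ connect e j i.
Proof.
move=> eij; apply/negP => /connectP[s pjs si].
by have := e_acyclic (c := j :: s); rewrite /= rcons_path pjs -si => /(_ eij).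
Qed.

Lemma parents_sub_nondesc i : parents e i \subset nondesc e i.
Proof.
apply/subsetP => j; rewrite !inE => eji; rewrite arc_notC// andbT.
by apply: contraTneq (arc_notC eji) => ->; rewrite connect0.
Qed.

(** Take a node outside [A] with the fewest ancestors, itself counted. A parent outside [A] would
    have strictly fewer, since by acyclicity a node is not an ancestor of its own parent. *)
Lemma exists_minimal A :
  A != [set: 'I_n]%SET -> exists2 i, i \notin A & parents e i \subset A.
Proof.
rewrite -subTset => /subsetPn[i0 _ i0A].
pose anc i := #|[set k | connect e k i]%SET|.
case: (@arg_minnP _ i0 [pred i | i \notin A] anc i0A) => i /= iA i_min.
exists i => //; apply/subsetP => j; rewrite inE => eji.
apply: contraT => /i_min; rewrite leqNgt => /negP[].
apply/proper_card/properP; split.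
  by apply/subsetP => k; rewrite !inE => /connect_trans; apply; exact: connect1.
by exists i; rewrite !inE ?connect0 ?arc_notC.
Qed.

(** Induction along a topological order that begins with [A0]: [exists_minimal] supplies the next
    node, and the number of missing nodes decreases. *)
Lemma ancestral_ind (A0 : {set 'I_n}) (P : {set 'I_n} -> Prop) :
  ancestral e A0 -> P A0 ->
  (forall A i, A0 \subset A -> ancestral e A -> i \notin A ->
     parents e i \subset A -> P A -> P (i |: A)%SET) ->
  P [set: 'I_n]%SET.
Proof.
move=> anc0 P0 PS.
suff: forall m A, (#|~: A| <= m)%N -> A0 \subset A -> ancestral e A -> P A ->
    P [set: 'I_n]%SET.
  by move/(_ _ A0 (leqnn _)); exact.
elim=> [|m IH] A cA sA ancA PA.
  by move: cA PA; rewrite leqn0 cards_eq0 -{2}(setCK A) => /eqP ->; rewrite setC0.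
have [<- //|/exists_minimal[i iA piA]] := eqVneq A [set: 'I_n]%SET.
apply: (IH (i |: A)%SET); last exact: PS.
- by rewrite setCU setIC -setDE -ltnS (leq_trans _ cA)// [leqRHS](cardsD1 i) inE iA.
- exact: (subset_trans sA (subsetUr _ _)).
- exact: ancestralU1.
Qed.

End Ancestral.

(** * Restrictions and one-coordinate updates of configurations *)

Section Restriction.
Import boot.fintype boot.finset.
Variables (n : nat) (X : 'I_n -> finType).
Implicit Types (A B : {set 'I_n}) (x y : joint X).

Definition upd x (i : 'I_n) (a : X i) : joint X :=
  [ffun j : 'I_n => dfwith x i a j].

Lemma upd_eq x i (a : X i) : upd x a i = a.
Proof. by rewrite ffunE dfwithin. Qed.

Lemma upd_neq x i (a : X i) j : i != j -> upd x a j = x j.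
Proof. by move=> ij; rewrite ffunE dfwithout. Qed.

Lemma restrP A x y :
  reflect (forall j, j \in A -> x j = y j) (restr A x == restr A y).
Proof.
apply: (iffP eqP) => [/ffunP xy j jA|xy].
  by have := xy (exist _ j jA); rewrite !ffunE.
by apply/ffunP => -[j jA]; rewrite !ffunE /=; exact: xy.
Qed.

Lemma eq_restrS A B x y :
  A \subset B -> restr B x = restr B y -> restr A x = restr A y.
Proof.
by move=> /subsetP AB /eqP/restrP xy; apply/eqP/restrP => j /AB; exact: xy.
Qed.

Lemma restr_upd A x i (a : X i) : i \notin A -> restr A (upd x a) = restr A x.
Proof.
move=> iA; apply/eqP/restrP => j jA; apply: upd_neq.
by rewrite eq_sym (memPn iA).
Qed.

Lemma restrU1 A i x y :
  (restr (i |: A)%SET x == restr (i |: A)%SET y) =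
  (restr A x == restr A y) && (x i == y i).
Proof.
apply/restrP/andP => [xy|[/restrP xy /eqP xyi] j].
  split; last by apply/eqP/xy; rewrite setU11.
  by apply/restrP => j jA; apply: xy; rewrite setU1r.
by rewrite in_setU1 => /predU1P[->|/xy].
Qed.

Lemma restr_setT x y :
  (restr [set: 'I_n]%SET x == restr [set: 'I_n]%SET y) = (x == y).
Proof.
apply/restrP/eqP => [xy|-> //]; apply/ffunP => j; exact: xy.
Qed.

End Restriction.

(** * Marginals, and conditionals as ratios of marginals *)

Section Marginals.
Variables (R : realType) (n : nat) (X : 'I_n -> finType).
Implicit Types (A : {set 'I_n}) (x y : joint X) (p : joint X -> R).

Lemma marg_setT p y : marg p (restr [set: 'I_n]%SET y) = p y.
Proof. by rewrite /marg (eq_bigl _ _ (fun x => restr_setT x y)) big_pred1_eq. Qed.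

Lemma marg_set0 p y : marg p (restr finset.set0 y) = \sum_x p x.
Proof. by apply: eq_bigl => x; apply/restrP => j; rewrite inE. Qed.

Lemma marg_ge0 p A (y : subjoint X A) : (forall x, 0 <= p x) -> 0 <= marg p y.
Proof. by move=> p0; apply: sumr_ge0. Qed.

Lemma margU1 p A i y (a : X i) : i \notin A ->
  marg p (restr (i |: A)%SET (upd y a)) =
  \sum_(x | (restr A x == restr A y) && (x i == a)) p x.
Proof. by move=> iA; apply: eq_bigl => x; rewrite restrU1 restr_upd// upd_eq. Qed.

Lemma marg_sum p A i y : i \notin A ->
  marg p (restr A y) =
  \sum_(a : X i) marg p (restr (i |: A)%SET (upd y a)).
Proof.
move=> iA; rewrite /marg (partition_big (fun x => x i) xpredT)//=.
by apply: eq_bigr => a _; rewrite -margU1.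
Qed.

Lemma condpE p A i y (a : X i) : i \notin A ->
  condp p (restr A y) a =
  marg p (restr (i |: A)%SET (upd y a)) / marg p (restr A y).
Proof. by move=> iA; rewrite margU1. Qed.

Lemma condp_pmf p A i y : (forall x, 0 <= p x) -> i \notin A ->
  0 < marg p (restr A y) -> is_pmf (condp p (i := i) (restr A y)).
Proof.
move=> p0 iA my; split=> [a|]; first by rewrite condpE// divr_ge0 ?marg_ge0.
under eq_bigr do rewrite condpE//.
by rewrite -mulr_suml -marg_sum// divff// gt_eqF.
Qed.

End Marginals.

(** * Products of kernels satisfy epistemic irrelevance *)

Section KernelProduct.
Import boot.fintype boot.finset.
Variables (R : realType) (n : nat) (X : 'I_n -> finType) (e : rel 'I_n).
Hypothesis e_acyclic : acyclic e.
Variable k : forall i : 'I_n, subjoint X (parents e i) -> X i -> R.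
Hypothesis k_pmf : forall i y, is_pmf (@k i y).

Definition kernel_prod (x : joint X) : R :=
  \prod_i k (restr (parents e i) x) (x i).

(** Sum out the nodes outside [A], children before parents: each kernel then sums to 1. *)
Lemma marg_kernel_prod (A : {set 'I_n}) (y : joint X) : ancestral e A ->
  marg kernel_prod (restr A y) =
  \prod_(i in A) k (restr (parents e i) y) (y i).
Proof.
move=> ancA.
pose M B := forall z, marg kernel_prod (restr B z) =
  \prod_(i in B) k (restr (parents e i) z) (z i).
suff MA : M A by exact: MA.
have: M [set: 'I_n]%SET.
  by move=> z; rewrite marg_setT /kernel_prod; apply: eq_bigl => i; rewrite inE.
(* The formula is known on the full set and has to descend to [A], whereas [ancestral_ind] ascends;
   hence the induction is on the implication from [M B] to [M A]. *)
pattern [set: 'I_n]%SET; apply: (ancestral_ind e_acyclic ancA) => //.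
move=> B i _ ancB iB piB IH MiB; apply: IH => z.
(* No node of the ancestral set [B] has [i] as a parent, so the kernels of [B] ignore the coordinate
   being summed out. *)
have ipar j : j \in B -> i \notin parents e j.
  by move=> jB; apply: contra iB; apply/subsetP; exact: ancB.
rewrite (marg_sum _ _ iB).
transitivity (\sum_(a : X i) k (restr (parents e i) z) a *
    \prod_(j in B) k (restr (parents e j) z) (z j)).
  apply: eq_bigr => a _; rewrite MiB big_setU1//= upd_eq restr_upd; last first.
    by apply: contra iB; exact: subsetP.
  congr (_ * _); apply: eq_bigr => j jB; rewrite restr_upd ?ipar// upd_neq//.
  by rewrite eq_sym (memPn iB).
by rewrite -mulr_suml (k_pmf _).2 mul1r.
Qed.

Lemma kernel_prod_pmf : (forall i, (0 < #|X i|)%N) -> is_pmf kernel_prod.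
Proof.
move=> X_nonempty; split=> [x|]; first by apply: prodr_ge0 => i _; apply: (k_pmf _).1.
have y : joint X by exact: [ffun i => enum_val (Ordinal (X_nonempty i))].
rewrite -(marg_set0 _ y) marg_kernel_prod ?big_set0// => i; by rewrite inE.
Qed.

Lemma margU1_kernel_prod A i (y : joint X) :
  ancestral e A -> i \notin A -> parents e i \subset A ->
  marg kernel_prod (restr (i |: A)%SET y) =
  k (restr (parents e i) y) (y i) * marg kernel_prod (restr A y).
Proof.
move=> ancA iA piA; rewrite !marg_kernel_prod ?big_setU1//.
exact: ancestralU1.
Qed.

(** The set [nondesc e i] is ancestral and contains the parents of [i], so adding [i] multiplies its
    marginal by a single kernel factor, which the quotient isolates. *)
Lemma condp_kernel_prod i (y : joint X) :
  0 < marg kernel_prod (restr (nondesc e i) y) ->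
  condp kernel_prod (i := i) (restr (nondesc e i) y) = k (restr (parents e i) y).
Proof.
move=> my; have ancN : ancestral e (nondesc e i) by exact: ancestral_nondesc.
have iN : i \notin nondesc e i by rewrite inE eqxx.
have piN := parents_sub_nondesc e_acyclic i.
have iP : i \notin parents e i by apply: contra iN; exact: subsetP.
apply/funext => a; rewrite condpE// margU1_kernel_prod// upd_eq !restr_upd//.
by rewrite mulfK// gt_eqF.
Qed.

End KernelProduct.

(** * Factorization of the elements of the epistemic extension *)

Section Network.
Import boot.fintype boot.finset.
Variables (R : realType) (n : nat) (X : 'I_n -> finType) (N : credal_net R X).
Implicit Types (A : {set 'I_n}) (x y : joint X) (p : joint X -> R).

Let e := Defs.arc N.
Let e_acyclic : acyclic e := @arc_acyclic _ _ _ N.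

Lemma kernel_prod_epistemic (X_nonempty : forall i, (0 < #|X i|)%N)
    (k : forall i : 'I_n, subjoint X (pa N i) -> X i -> R) :
  (forall i (z : subjoint X (pa N i)), lcs z (k i z)) -> epistemic_ext N (kernel_prod k).
Proof.
move=> kl; have k_pmf i (z : subjoint X (pa N i)) : is_pmf (k i z).
  by have [+ _ _] := lcs_credal z; apply; exact: kl.
split; first exact: (kernel_prod_pmf e_acyclic).
by move=> i x mx; rewrite (condp_kernel_prod e_acyclic k_pmf mx).
Qed.

(** Irrelevance is silent on null events. The division-free form covers them too, both sides being 0
    there. *)
Lemma epistemic_sum_nd p i (k : X i -> R) a x :
  epistemic_ext N p -> lcs (restr (pa N i) x) = [set k]%classic ->
  \sum_(w | (restr (nd N i) w == restr (nd N i) x) && (w i == a)) p w =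
  k a * marg p (restr (nd N i) x).
Proof.
move=> [[p0 _] pepi] lk.
have [mx0|mx] := eqVneq (marg p (restr (nd N i) x)) 0.
  rewrite mx0 mulr0; apply: big1 => w /andP[xw _].
  by move: w xw; apply: psumr_eq0P.
have mpos : 0 < marg p (restr (nd N i) x) by rewrite lt0r mx marg_ge0.
have := pepi _ _ mpos; rewrite lk => /(congr1 (fun g => g a)) <-.
by rewrite /condp divfK.
Qed.

(* [A] may be smaller than [nd N i]: the irrelevance condition is averaged over
   the configurations of [nd N i] that agree with [x] on [A]. *)
Lemma epistemic_margU1 p i (k : X i -> R) A x :
  epistemic_ext N p -> lcs (restr (pa N i) x) = [set k]%classic ->
  pa N i \subset A -> A \subset nd N i ->
  marg p (restr (i |: A)%SET x) = k (x i) * marg p (restr A x).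
Proof.
move=> pepi lk piA Ai; rewrite /marg.
under eq_bigl do rewrite restrU1.
rewrite !(partition_big (restr (nd N i)) xpredT)//= mulr_sumr.
apply: eq_bigr => z _.
(* A class [z] either misses the configurations agreeing with [x] on [A], and both sums are empty,
   or lies wholly among them because [A] is included in [nd N i]. *)
have [w /andP[/eqP wx /eqP wz]|none] :=
  pickP [pred w | (restr A w == restr A x) && (restr (nd N i) w == z)]; last first.
  by rewrite !big_pred0 ?mulr0// => w; have := none w; rewrite /= // andbAC => ->.
have zA v : (restr A v == restr A x) && (restr (nd N i) v == z) =
    (restr (nd N i) v == restr (nd N i) w).
  rewrite wz andb_idl// -wz -wx => /eqP vw; apply/eqP; exact: eq_restrS vw.
under eq_bigl do rewrite andbAC zA.
rewrite (eq_bigl _ _ zA); apply: epistemic_sum_nd pepi _.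
by rewrite -lk; congr (lcs _); apply: eq_restrS wx.
Qed.

Definition roots : {set 'I_n} := [set i | is_root N i]%SET.

Lemma ancestral_roots : ancestral e roots.
Proof.
move=> i; rewrite inE => /eqP pi0.
by rewrite -[parents _ _]/(pa N i) pi0 sub0set.
Qed.

Lemma epistemic_factor p (k : forall i : 'I_n, subjoint X (pa N i) -> X i -> R) x :
  epistemic_ext N p ->
  (forall i z, ~~ is_root N i -> lcs z = [set k i z]%classic) ->
  p x = marg p (restr roots x) *
    \prod_(i | i \notin roots) k i (restr (pa N i) x) (x i).
Proof.
move=> pepi lk.
(* Invariant of the chain rule: each processed node moves its kernel from the product into the
   marginal. *)
pose P A := marg p (restr roots x) *
  \prod_(i | i \notin roots) k i (restr (pa N i) x) (x i) =
  marg p (restr A x) * \prod_(i | i \notin A) k i (restr (pa N i) x) (x i).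
have : P [set: 'I_n]%SET; last first.
  by rewrite /P marg_setT [in RHS]big_pred0 ?mulr1// => i; rewrite inE.
apply: (ancestral_ind e_acyclic ancestral_roots) => // A i rA ancA iA piA.
rewrite /P => ->.
have iroot : ~~ is_root N i.
  by apply: contra iA => ri; apply: (subsetP rA); rewrite inE.
rewrite (epistemic_margU1 pepi (lk _ _ iroot) piA (sub_nondesc ancA iA)).
rewrite (bigD1 i iA)/= mulrCA mulrA; congr (_ * _).
by apply: eq_bigl => j; rewrite in_setU1 negb_or andbC.
Qed.

End Network.

(** * Extreme points, convex hulls and minima *)

Section Extremes.
Variable R : realType.

Lemma ext_set1 (E : lmodType R) (p : E) : ext [set p] p.
Proof. by split=> // u v t -> ->. Qed.

Definition unit_mass (Z : finType) (a : Z) : Z -> R := fun z => (z == a)%:R.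

Lemma unit_mass_pmf (Z : finType) (a : Z) : is_pmf (unit_mass a).
Proof.
split=> [z|]; first exact: ler0n.
by rewrite (bigD1 a)//= /unit_mass eqxx big1 ?addr0// => z /negPf ->.
Qed.

Lemma pmf_eq_unit_mass (Z : finType) (a : Z) (u : Z -> R) :
  is_pmf u -> (forall z, z != a -> u z = 0) -> u = unit_mass a.
Proof.
move=> [_ u1] u0; apply/funext => z; rewrite /unit_mass.
have [->|/u0//] := eqVneq z a.
by rewrite -u1 (bigD1 a)//= big1 ?addr0.
Qed.

(** Off [a], a combination of non-negative terms with positive weights vanishes, so both [u] and [v]
    vanish there and total mass 1 determines them. *)
Lemma ext_pmf_unit_mass (Z : finType) (a : Z) :
  ext (@is_pmf R Z) (unit_mass a).
Proof.
split=> [|u v t pu pv /andP[t0 t1] uv]; first exact: unit_mass_pmf.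
have uv0 z : z != a -> u z = 0 /\ v z = 0.
  move=> za; have := congr1 (fun g => g z) uv.
  rewrite /unit_mass (negPf za) => /esym/eqP.
  rewrite paddr_eq0 ?mulr_ge0 ?pu.1 ?pv.1 ?subr_ge0 ?(ltW t0) ?(ltW t1)//.
  rewrite !mulf_eq0 (gt_eqF t0) subr_eq0 (gt_eqF t1)/=.
  by move=> /andP[/eqP + /eqP].
rewrite (pmf_eq_unit_mass pu (fun z za => (uv0 z za).1)).
by rewrite (pmf_eq_unit_mass pv (fun z za => (uv0 z za).2)).
Qed.

Lemma conv_hullW (E : lmodType R) (A : set E) : A `<=` conv_hull A.
Proof.
move=> p Ap; exists 1%N, (fun=> 1), (fun=> p).
by split=> //; rewrite ?big_ord1 ?scale1r.
Qed.

Lemma is_min_unique (A : set R) (a b : R) : is_min A a -> is_min A b -> a = b.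
Proof. by move=> [Aa la] [Ab lb]; apply/eqP; rewrite eq_le la ?lb. Qed.

End Extremes.

(** * The generalized Bayes rule as a lower expectation *)

Section GeneralizedBayes.
Variables (R : realType) (n : nat) (X : 'I_n -> finType).
Variables (C : set (joint X -> R)) (q : 'I_n) (f : X q -> R).
Hypothesis C_pmf : C `<=` @is_pmf R (joint X).

(** Total mass 1 turns the objective into the expectation of [f] minus [mu], so the two minima
    differ by a translation. *)
Lemma gbr_lower_expect mu : gbr_sol C f mu <-> lower_expect C f mu.
Proof.
have E p : C p -> \sum_(x : joint X) (f (x q) - mu) * p x =
    expect p (fun x : joint X => f (x q)) - mu.
  move=> /C_pmf[_ p1]; rewrite -[X in _ - X](mulr1) -p1 mulr_sumr -sumrB.
  by apply: eq_bigr => x _; rewrite mulrBl.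
split=> -[[p Cp pmu] lb]; split.
- exists p => //; apply/eqP; rewrite -subr_eq0 -E//; exact/eqP.
- move=> _ [s Cs <-]; rewrite -subr_ge0 -E//; apply: lb; by exists s.
- by exists p => //; rewrite E// pmu subrr.
- move=> _ [s Cs <-]; rewrite E// subr_ge0; apply: lb; by exists s.
Qed.

Lemma unique_gbr_sol mu : lower_expect C f mu -> unique (gbr_sol C f) mu.
Proof.
move=> Cmu; split=> [|nu /gbr_lower_expect]; first exact/gbr_lower_expect.
exact: is_min_unique.
Qed.

End GeneralizedBayes.

(** * Vertices indexed by root values, and mixtures of them *)

Section Vertices.
Variables (R : realType) (n : nat) (X : 'I_n -> finType) (N : credal_net R X).
Hypothesis X_nonempty : forall i, (0 < #|X i|)%N.

Lemma strong_ext_pmf : strong_ext N `<=` @is_pmf R (joint X).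
Proof.
move=> p [m [w [s [w0 w1 sV ->]]]]; have spmf k : is_pmf (s k) by case: (sV k).
split=> [x|].
  rewrite fct_sumE; apply: sumr_ge0 => k _.
  by apply: mulr_ge0 => //; exact: (spmf k).1.
under eq_bigr do rewrite fct_sumE.
rewrite exchange_big /= -w1; apply: eq_bigr => k _.
by rewrite -mulr_sumr (spmf k).2 mulr1.
Qed.

Hypothesis nonroot_precise : forall i, ~~ is_root N i ->
  forall y : subjoint X (pa N i), exists p : X i -> R, lcs y = [set p].
Hypothesis root_vacuous : forall i, is_root N i ->
  forall y : subjoint X (pa N i), lcs y = [set p : X i -> R | is_pmf p].

(** Only the root coordinates of [r] matter; a full configuration is used so that the weights of the
    mixture can be [p r] itself. At a precise node [xget] extracts the unique element, and its
    default value is never reached. *)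
Definition vertex_kernel (r : joint X) (i : 'I_n) (y : subjoint X (pa N i)) :
    X i -> R :=
  if is_root N i then @unit_mass R _ (r i) else xget (fun=> 0) (lcs y).

Definition vertex (r : joint X) : joint X -> R := kernel_prod (vertex_kernel r).

Lemma lcs_vertex_kernel r i (y : subjoint X (pa N i)) :
  ~~ is_root N i -> lcs y = [set vertex_kernel r y].
Proof.
move=> ri; have [p yp] := nonroot_precise ri y.
rewrite /vertex_kernel (negPf ri) yp; congr [set _].
by rewrite (@xget_subset1 _ _ _ p)// => u v -> ->.
Qed.

Lemma ext_vertex_kernel r i (y : subjoint X (pa N i)) :
  ext (lcs y) (vertex_kernel r y).
Proof.
have [ri|ri] := boolP (is_root N i).
  by rewrite root_vacuous// /vertex_kernel ri; exact: ext_pmf_unit_mass.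
by rewrite (lcs_vertex_kernel r y ri); exact: ext_set1.
Qed.

Lemma vertex_epistemic r : epistemic_ext N (vertex r).
Proof.
by apply: kernel_prod_epistemic => // i y; have [] := ext_vertex_kernel r y.
Qed.

Lemma vertex_strong r : strong_ext N (vertex r).
Proof.
apply: conv_hullW; split; first by have [] := vertex_epistemic r.
by exists (vertex_kernel r); split=> // i y; exact: ext_vertex_kernel.
Qed.

(** The point masses at the roots multiply to an indicator. The other kernels do not depend on [r],
    so writing them with [x] leaves the indicator as the only trace of [r]. *)
Lemma vertexE r x : vertex r x = (restr (roots N) r == restr (roots N) x)%:R *
  \prod_(i | i \notin roots N) vertex_kernel x (restr (pa N i) x) (x i).
Proof.
rewrite /vertex /kernel_prod (bigID [in roots N])/=; congr (_ * _); last first.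
  by apply: eq_bigr => i; rewrite inE /vertex_kernel => /negPf ->.
case: restrP => [rx|nrx].
  apply: big1 => i iR; have := iR; rewrite inE /vertex_kernel => ->.
  by rewrite /unit_mass rx// eqxx.
apply/eqP/prodf_eq0; apply: contrapT => no; apply: nrx => i iR.
apply: contrapT => rxi; apply: no; exists i => //.
have := iR; rewrite inE /vertex_kernel => ->; rewrite /unit_mass pnatr_eq0 eqb0.
by apply/eqP => xri; exact: rxi.
Qed.

(** Weighting by [p r] over all configurations, the indicator in [vertexE] collects exactly the
    marginal of the roots that appears in [epistemic_factor]. *)
Lemma epistemic_mixture p x : epistemic_ext N p ->
  p x = \sum_r p r * vertex r x.
Proof.
move=> pepi; rewrite (epistemic_factor (k := vertex_kernel x) x pepi); last first.
  by move=> i z; exact: lcs_vertex_kernel.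
rewrite /marg mulr_suml big_mkcond/=; apply: eq_bigr => r _.
by rewrite vertexE; case: ifP => _; rewrite ?mul1r// mul0r mulr0.
Qed.

Lemma epistemic_expect_ge p g mu : epistemic_ext N p ->
  (forall r, mu <= expect (vertex r) g) -> mu <= expect p g.
Proof.
move=> pepi le_mu; have [[p0 p1] _] := pepi.
rewrite -[mu]mulr1 -p1 mulr_sumr.
apply: (@le_trans _ _ (\sum_r expect (vertex r) g * p r)).
  by apply: ler_sum => r _; exact: ler_wpM2r.
rewrite /expect; under eq_bigr do rewrite mulr_suml.
rewrite exchange_big/=; apply: ler_sum => x _.
rewrite (epistemic_mixture x pepi) mulr_sumr; apply: ler_sum => r _.
by rewrite mulrAC mulrA.
Qed.

(** The generators of the hull are kernel products, hence epistemic, so the previous bound applies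
    without classifying the extreme points of the simplex; linearity extends it to mixtures. *)
Lemma strong_expect_ge p g mu : strong_ext N p ->
  (forall r, mu <= expect (vertex r) g) -> mu <= expect p g.
Proof.
move=> [m [w [s [w0 w1 sV ->]]]] le_mu.
have s_ge k : mu <= expect (s k) g.
  have [_ [c [cext sE]]] := sV k.
  rewrite (_ : s k = kernel_prod c); last exact/funext.
  apply: epistemic_expect_ge le_mu.
  by apply: kernel_prod_epistemic => // i y; have [] := cext i y.
have -> : expect (\sum_k w k *: s k) g = \sum_k w k * expect (s k) g.
  rewrite /expect; under eq_bigr do rewrite fct_sumE mulr_sumr.
  rewrite exchange_big/=; apply: eq_bigr => k _; rewrite mulr_sumr.
  by apply: eq_bigr => x _; rewrite mulrCA.
by rewrite -[mu]mul1r -w1 mulr_suml; apply: ler_sum => k _; exact: ler_wpM2l.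
Qed.

End Vertices.

Theorem lemma2 (R : realType) (n : nat) (X : 'I_n -> finType)
    (X_nonempty : forall i, (0 < #|X i|)%N) (N : credal_net R X)
    (nonroot_precise : forall i, ~~ is_root N i ->
       forall y : subjoint X (pa N i), exists p : X i -> R, lcs y = [set p])
    (root_vacuous : forall i, is_root N i ->
       forall y : subjoint X (pa N i), lcs y = [set p : X i -> R | is_pmf p])
    (q : 'I_n) (q_nonroot : ~~ is_root N q) (f : X q -> R) :
  exists mu : R,
    [/\ unique (gbr_sol (epistemic_ext N) f) mu,
        unique (gbr_sol (strong_ext N) f) mu,
        lower_expect (epistemic_ext N) f mu
      & lower_expect (strong_ext N) f mu].
Proof.
pose g (x : joint X) := f (x q).
pose r0 : joint X := [ffun i => enum_val (Ordinal (X_nonempty i))].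
pose E r := expect (vertex N r) g.
(* There are finitely many configurations, so a minimizing vertex exists; [r0] witnesses that the
   index set is nonempty. *)
have [r _ /(_ _ isT) r_min] := @arg_minP _ _ _ r0 xpredT E isT.
have lowe : lower_expect (epistemic_ext N) f (E r).
  split; first by exists (vertex N r) => //; exact: vertex_epistemic.
  by move=> _ [p pe <-]; exact: epistemic_expect_ge pe r_min.
have lows : lower_expect (strong_ext N) f (E r).
  split; first by exists (vertex N r) => //; exact: vertex_strong.
  by move=> _ [p ps <-]; exact: strong_expect_ge ps r_min.
exists (E r); split=> //; apply: unique_gbr_sol => //.
- by move=> p [].
- exact: strong_ext_pmf.
Qed.
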